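(* Let $x>0$ be a real number, $d\ge 1$ an integer, and $r$ a nonzero real number with $r^2\neq x$. Let $g(t)=\frac{1}{t^2-x}$ and let $\{\mathcal{H}_n\}_{n\ge 0}$ be the sequence of Householder's method of order $d$ for $\sqrt{x}$ with starting point $r$: $$\mathcal{H}_0=r,\qquad \mathcal{H}_{n+1}=\mathcal{H}_n+d\,\frac{g^{(d-1)}(\mathcal{H}_n)}{g^{(d)}(\mathcal{H}_n)}\quad(n\ge 0).$$ Put $X=\frac{x+r^2}{x-r^2}$. (1) If $d$ is even, $d=2p$, then for every $n\ge 0$, $$\mathcal{H}_n=r\,\frac{\prod_{j=1}^{n}W_p\left(T_{(2p+1)^{j-1}}(X)\right)}{\prod_{j=1}^{n}V_p\left(T_{(2p+1)^{j-1}}(X)\right)}$$ and $$\mathcal{H}_{n+1}-\mathcal{H}_n=2\mathcal{H}_n\,\frac{U_{p-1}\left(T_{(2p+1)^n}(X)\right)}{V_p\left(T_{(2p+1)^n}(X)\right)}.$$ (2) If $d$ is odd, write uniquely $d=2^{\alpha+1}p+2^{\alpha}-1$ with integers $\alpha\ge 1$ and $p\ge 0$ (so $\alpha$ is the 2-adic valuation of $d+1$). Then for every $n\ge 1$, $$\mathcal{H}_n=\frac{r}{2^{\alpha n-1}}\cdot\frac{T_{\frac{(d+1)^n}{2}}(X)}{(X-1)\displaystyle\prod_{j=0}^{n-2}T_{\frac{(d+1)^{j+1}}{2}}(X)\prod_{j=0}^{n-1}\prod_{k=0}^{\alpha-2}T_{2^k(d+1)^j}(X)\prod_{j=0}^{n-1}W_p\left(T_{2^{\alpha}(d+1)^j}(X)\right)}.$$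 Moreover, with $X_n=T_{\frac{(d+1)^n}{2}}(X)$, for every $n\ge 1$, $$\mathcal{H}_{n+1}=\mathcal{H}_n\,\frac{T_{d+1}(X_n)}{X_n\,U_d(X_n)} \qquad\text{and}\qquad \mathcal{H}_{n+1}-\mathcal{H}_n=-\mathcal{H}_n\,\frac{U_{d-1}(X_n)}{X_n\,U_d(X_n)}.$$
   Context: $g^{(m)}$ denotes the $m$-th derivative of $g$ ($g^{(0)}=g$). $T_k,U_k,V_k,W_k$ denote the Chebyshev polynomials of the first, second, third and fourth kind. All four families satisfy $P_{k+2}(X)=2XP_{k+1}(X)-P_k(X)$ for $k\ge 0$, with initial values $T_0=1,\ T_1=X$; $U_0=1,\ U_1=2X$; $V_0=1,\ V_1=2X-1$; $W_0=1,\ W_1=2X+1$. Empty products equal $1$. *)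

(* Defs.v *)
From mathcomp Require Import all_boot all_order all_algebra.
Import GRing.Theory.

Set Implicit Arguments.
Unset Strict Implicit.
Unset Printing Implicit Defensive.

Local Open Scope ring_scope.

(* The four kinds of Chebyshev polynomials differ only in their degree-one
   term [P1]. *)
Fixpoint cheb (R : nzRingType) (P1 : {poly R}) (n : nat) : {poly R} :=
  match n with
  | 0 => 1
  | 1 => P1
  | (k.+1 as m).+1 => 2 * 'X * cheb P1 m - cheb P1 k
  end.

Definition chebT {R : nzRingType} (n : nat) : {poly R} := cheb 'X n.
Definition chebU {R : nzRingType} (n : nat) : {poly R} := cheb (2 * 'X) n.
Definition chebV {R : nzRingType} (n : nat) : {poly R} := cheb (2 * 'X - 1) n.
Definition chebW {R : nzRingType} (n : nat) : {poly R} := cheb (2 * 'X + 1) n.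

(* Main.v *)
Require Import Defs.
From mathcomp Require Import all_boot all_order all_algebra.
From mathcomp Require Import all_classical all_reals all_analysis.
From mathcomp Require Import ring zify.
Import Order.TTheory GRing.Theory Num.Theory.
Import numFieldNormedType.Exports.

(** Two substitutions turn Householder's method into exponentiation.

    Let [s] be the square root of [x].  The partial fraction decomposition of
    1 / (t^2 - s^2) gives all its derivatives in closed form
    ([derive1n_inv_sqrB]), and in the coordinate q = (t + s) / (t - s), whose
    inverse is t = s * [cayley] q, one step of the method of order d is exactly
    q |-> q^(d+1) ([householder_step]).  Hence
    H_n = s * cayley (q0 ^ ((d+1)^n)) with q0 = (r + s) / (r - s).

    On the other side, put z = - q0.  Then X = (z + 1/z) / 2 = [jouk] z, and at
    such a point Chebyshev polynomials are Laurent polynomials in z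
    ([cheb_binet]); in particular T_m (jouk z) = jouk (z^m), so the nested
    arguments in the statement are jouk of powers of z.  Every formula of the
    theorem is then an identity between rational functions of z:
    - for d = 2p, W_p / V_p at jouk z is the quotient of cayley (- z^(2p+1)) by
      cayley (- z) ([chebWV_cayley]), so that each step contributes one factor
      W_p / V_p, and W_p - V_p = 2 U_(p-1) gives the increment;
    - for d odd, T_m / U_(m-1) at jouk z is cayley (z^(2m)) up to a factor that
      does not depend on m ([chebTU_cayley]).  This relates H_n to H_(n+1), and
      H_0 to H_1, by a quotient T / U; the products over T and W come
      from factoring U_(2^a (2p+1) - 1) by the double-angle formula
      ([chebU_factor]).

    All denominators are nonzero because z is real and differs from 0, 1 and
    -1: then |z| <> 1, which passes to all powers z^m with m > 0 and excludes
    z^m = 1 and z^m = -1, while jouk z = 0 would mean z^2 = -1. *)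

Set Implicit Arguments.
Unset Strict Implicit.
Unset Printing Implicit Defensive.

Local Open Scope ring_scope.

(** The Joukowski map: with z = exp (i theta) it is cos theta, which is why it
    linearizes Chebyshev polynomials. *)
Definition jouk (F : fieldType) (z : F) : F := (z + z^-1) / 2.

(** The Moebius map sending 0 and infinity to -1 and 1; [s * cayley] sends them
    to the two fixed points of Householder's method. *)
Definition cayley (F : fieldType) (q : F) : F := (q + 1) / (q - 1).

(** * Chebyshev polynomials on the image of the Joukowski map *)

Section Chebyshev.
Variable R : realFieldType.
Implicit Types (z q s : R) (n m p : nat).

(** Since z + 1/z = 2 jouk z, both z^n and z^(-n) satisfy the common recurrence
    at jouk z.  The factor c clears the denominator of the solution: 2, z - 1/z,
    z + 1 and z - 1 for the first to fourth kinds. *)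
Lemma cheb_binet (P1 : {poly R}) z a b c n :
  z != 0 -> c = a + b -> c * P1.[jouk z] = a * z + b * z^-1 ->
  c * (cheb P1 n).[jouk z] = a * z ^+ n + b * z ^- n.
Proof.
move=> z0 c0 c1.
suff [] : c * (cheb P1 n).[jouk z] = a * z ^+ n + b * z ^- n /\
          c * (cheb P1 n.+1).[jouk z] = a * z ^+ n.+1 + b * z ^- n.+1 by [].
elim: n => [|n [IH0 IH1]].
  by rewrite /= hornerC c1 !expr0 !expr1 invr1 !mulr1.
split=> //.
rewrite -[cheb P1 n.+2]/(2 * 'X * cheb P1 n.+1 - cheb P1 n) -polyC_natr.
rewrite !(hornerD, hornerN, hornerM, hornerX, hornerC) mulrBr.
rewrite (_ : c * _ = 2 * jouk z * (c * (cheb P1 n.+1).[jouk z])); last by ring.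
rewrite IH1 IH0 /jouk !exprS !invfM; field.
by rewrite z0 expf_neq0.
Qed.

Lemma chebT_jouk z n : z != 0 -> (chebT n).[jouk z] = jouk (z ^+ n).
Proof.
move=> z0; apply: (@mulfI _ 2); first by rewrite pnatr_eq0.
rewrite (@cheb_binet _ z 1 1) // ?hornerX /jouk.
  by field; rewrite expf_neq0.
by field.
Qed.

Lemma chebU_jouk z n : z != 0 ->
  (z - z^-1) * (chebU n).[jouk z] = z ^+ n.+1 - z ^- n.+1.
Proof.
move=> z0; rewrite (@cheb_binet _ z z (- z^-1)) // -?polyC_natr
  ?(hornerD, hornerN, hornerM, hornerX, hornerC) /jouk.
  by rewrite !exprS invfM; ring.
by field.
Qed.

Lemma chebV_jouk z n : z != 0 ->
  (z + 1) * (chebV n).[jouk z] = z ^+ n.+1 + z ^- n.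
Proof.
move=> z0; rewrite (@cheb_binet _ z z 1) // -?polyC_natr
  ?(hornerD, hornerN, hornerM, hornerX, hornerC) /jouk.
  by rewrite exprS mul1r.
by field.
Qed.

Lemma chebW_jouk z n : z != 0 ->
  (z - 1) * (chebW n).[jouk z] = z ^+ n.+1 - z ^- n.
Proof.
move=> z0; rewrite (@cheb_binet _ z z (- 1)) // -?polyC_natr
  ?(hornerD, hornerN, hornerM, hornerX, hornerC) /jouk.
  by rewrite exprS; ring.
by field.
Qed.

(** Both sides satisfy the common recurrence, so only the first two values of n
    matter. *)
Lemma chebW_chebV n : chebW n.+1 = chebV n.+1 + 2 * chebU n :> {poly R}.
Proof.
suff [] : chebW n.+1 = chebV n.+1 + 2 * chebU n :> {poly R} /\
          chebW n.+2 = chebV n.+2 + 2 * chebU n.+1 :> {poly R} by [].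
rewrite /chebW /chebV /chebU.
elim: n => [|n [IH0 IH1]]; first by split => /=; ring.
split=> //.
rewrite -[cheb (2 * 'X + 1) n.+3]/(2 * 'X * cheb _ n.+2 - cheb _ n.+1).
rewrite -[cheb (2 * 'X - 1) n.+3]/(2 * 'X * cheb _ n.+2 - cheb _ n.+1).
rewrite -[cheb (2 * 'X) n.+2]/(2 * 'X * cheb _ n.+1 - cheb _ n).
by rewrite IH0 IH1; ring.
Qed.

Lemma chebT_chebU n : chebT n.+2 = 'X * chebU n.+1 - chebU n :> {poly R}.
Proof.
suff [] : chebT n.+2 = 'X * chebU n.+1 - chebU n :> {poly R} /\
          chebT n.+3 = 'X * chebU n.+2 - chebU n.+1 :> {poly R} by [].
rewrite /chebT /chebU.
elim: n => [|n [IH0 IH1]]; first by split => /=; ring.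
split=> //.
rewrite -[cheb 'X n.+4]/(2 * 'X * cheb _ n.+3 - cheb _ n.+2).
rewrite -[cheb (2 * 'X) n.+3]/(2 * 'X * cheb _ n.+2 - cheb _ n.+1).
rewrite IH0 IH1 -[cheb (2 * 'X) n.+2]/(2 * 'X * cheb _ n.+1 - cheb _ n); ring.
Qed.

(** Telescoping of w^2 - w^(-2) = (w - 1/w) * 2 jouk w along the repeated
    squares of z: the iterated double-angle formula for the sine. *)
Lemma prod_jouk_dbl z m : z != 0 ->
  (z - z^-1) * (2 ^+ m * \prod_(0 <= k < m) jouk (z ^+ (2 ^ k))) =
    z ^+ (2 ^ m) - z ^- (2 ^ m).
Proof.
move=> z0; elim: m => [|m IH]; first by rewrite big_nil !mulr1 expn0 !expr1.
rewrite big_nat_recr //= exprSr.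
rewrite (_ : _ * _ = (z ^+ (2 ^ m) - z ^- (2 ^ m)) * (2 * jouk (z ^+ (2 ^ m)))).
  by rewrite expnS mulnC exprM /jouk; field; rewrite expf_neq0.
by rewrite -IH; ring.
Qed.

(** Over a real field, excluding |z| = 1 is the form of z <> 1, z <> -1 that is
    inherited by powers. *)
Lemma normX_neq1 z m : `|z| != 1 -> (0 < m)%N -> `|z ^+ m| != 1.
Proof. by move=> z1 m0; rewrite normrX pexpr_eq1// -lt0n. Qed.

Lemma norm_neq1 z : `|z| != 1 -> z - 1 != 0 /\ z + 1 != 0.
Proof.
move=> z1; rewrite subr_eq0 addr_eq0.
by split; apply: contraNneq z1 => ->; rewrite ?normrN normr1.
Qed.

Lemma sub_inv_neq0 z : z != 0 -> `|z| != 1 -> z - z^-1 != 0.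
Proof.
move=> z0 /norm_neq1[z1 z2].
rewrite (_ : z - z^-1 = (z - 1) * (z + 1) / z); last by field.
by rewrite !mulf_neq0 ?invr_neq0.
Qed.

Lemma jouk_neq0 z : z != 0 -> jouk z != 0.
Proof.
move=> z0; rewrite /jouk (_ : _ / 2 = (z ^+ 2 + 1) / (z * 2)); last by field.
rewrite mulf_neq0 ?invr_neq0 ?mulf_neq0 ?pnatr_eq0 //.
by rewrite gt_eqF // ltr_wpDl ?sqr_ge0.
Qed.

(** At z = exp (i t) this factors sin (2^m (2p+1) t) / sin t: the numerator is
    sin (2^m t) times the Dirichlet kernel W_p (cos (2^(m+1) t)), and
    sin (2^m t) unfolds by the double-angle formula. *)
Lemma chebU_factor z m p : z != 0 -> `|z| != 1 ->
  (chebU (2 ^ m * (2 * p + 1) - 1)%N).[jouk z] =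
  2 ^+ m * \prod_(0 <= k < m) (chebT (2 ^ k)%N).[jouk z]
    * (chebW p).[(chebT (2 ^ m.+1)%N).[jouk z]].
Proof.
move=> z0 z1; apply: (mulfI (sub_inv_neq0 z0 z1)).
have m_gt0 : (0 < 2 ^ m * (2 * p + 1))%N by rewrite muln_gt0 expn_gt0 addn1.
rewrite chebU_jouk // subn1 prednK // mulrA.
under eq_bigr do rewrite chebT_jouk //.
rewrite prod_jouk_dbl // chebT_jouk // expnSr !exprM.
set w := z ^+ (2 ^ m).
have w0 : w != 0 by rewrite expf_neq0.
have w1 : `|w| != 1 by rewrite normX_neq1 // expn_gt0.
have [ww _] := norm_neq1 (normX_neq1 w1 (isT : 0 < 2)%N).
apply: (mulfI ww).
have := chebW_jouk p (expf_neq0 2 w0).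
rewrite mulrCA => ->.
clearbody w; rewrite addn1 -!exprM mulnS exprD (exprS w (2 * p)); field.
by rewrite w0 expf_neq0.
Qed.

(** The factor contributed by one step of even order 2p: the coordinate - z goes
    to - z^(2p+1), the sign surviving because 2p+1 is odd. *)
Lemma chebWV_cayley z p : z != 0 -> `|z| != 1 ->
  (chebV p).[jouk z] != 0 /\
  cayley (- z ^+ (2 * p + 1)) =
    cayley (- z) * ((chebW p).[jouk z] / (chebV p).[jouk z]).
Proof.
move=> z0 z1; have [zm zp] := norm_neq1 z1.
have [ym yp] : z ^+ (2 * p + 1) - 1 != 0 /\ z ^+ (2 * p + 1) + 1 != 0.
  by apply/norm_neq1/normX_neq1; rewrite ?addn1.
have u0 : z ^+ p != 0 by rewrite expf_neq0.
have eW : (chebW p).[jouk z] = (z ^+ (2 * p + 1) - 1) / (z ^+ p * (z - 1)).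
  apply: (mulfI zm); rewrite chebW_jouk // exprS mul2n -addnn !exprD expr1.
  by field; rewrite zm.
have eV : (chebV p).[jouk z] = (z ^+ (2 * p + 1) + 1) / (z ^+ p * (z + 1)).
  apply: (mulfI zp); rewrite chebV_jouk // exprS mul2n -addnn !exprD expr1.
  by field; rewrite zp.
split; first by rewrite eV mulf_neq0 ?invr_neq0 ?mulf_neq0.
rewrite eW eV /cayley; field.
by rewrite u0 zm zp yp -!opprD !oppr_eq0 zp yp.
Qed.

(** The cotangent of (n+1) theta, up to a factor independent of n.  Dividing
    by the instance n = 0 removes this factor. *)
Lemma chebTU_cayley z n : z != 0 -> `|z| != 1 ->
  (chebU n).[jouk z] != 0 /\
  cayley (z ^+ (2 * n.+1)) = (chebT n.+1).[jouk z] / (chebU n).[jouk z]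
     * (2 / (z - z^-1)).
Proof.
move=> z0 z1; have zz := sub_inv_neq0 z0 z1.
have y0 : z ^+ n.+1 != 0 by rewrite expf_neq0.
have y1 := normX_neq1 z1 (ltn0Sn n).
have yy := sub_inv_neq0 y0 y1.
have eU : (chebU n).[jouk z] = (z ^+ n.+1 - z ^- n.+1) / (z - z^-1).
  by apply: (mulfI zz); rewrite chebU_jouk // mulrCA mulfV ?mulr1.
split; first by rewrite eU mulf_neq0 ?invr_neq0.
have [ym _] := norm_neq1 (normX_neq1 y1 (isT : 0 < 2)%N).
have [zm _] := norm_neq1 (normX_neq1 z1 (isT : 0 < 2)%N).
rewrite eU chebT_jouk // mulnC exprM /jouk /cayley.
set y := z ^+ n.+1 in y0 y1 yy ym *.
field.
by rewrite z0 y0 -!expr2 zm ym.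
Qed.

End Chebyshev.

(** * Householder's method in the Cayley coordinate *)

Section Householder.
Variable R : realType.
Implicit Types (s t q : R).

Lemma is_derive_invX (c t : R) (m : nat) : t - c != 0 ->
  is_derive t 1 (fun u => (u - c)^-1 ^+ m.+1) (- m.+1%:R * (t - c)^-1 ^+ m.+2).
Proof.
move=> tc.
have Dv : is_derive t (1 : R) (fun u : R => (u - c)^-1) (- (t - c) ^- 2).
  have Dl : is_derive t (1 : R) (fun u : R => u - c) 1.
    rewrite -[X in is_derive _ _ _ X]subr0.
    exact: (is_deriveB (is_derive_id _ _) (is_derive_cst _ _ _)).
  have D := @is_deriveV _ (fun u : R => u - c) t 1 1 tc Dl.
  by apply: (is_derive_eq D); rewrite [LHS]mulr1.
have D := is_deriveX m.+1 Dv.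
rewrite exprfctE in D.
apply: (is_derive_eq D).
rewrite -exprVn /= !exprS /GRing.scale /=; ring.
Qed.

(** Partial fractions: a derivative multiplies both polar terms by the same
    constant and raises their order by one.  As the formula fails at the poles,
    the induction step needs it near t and not only at t. *)
Lemma derive1n_inv_sqrB s n t : s != 0 -> t ^+ 2 != s ^+ 2 ->
  (fun u : R => 1 / (u ^+ 2 - s ^+ 2))^`(n)%classic t =
  (-1) ^+ n * n`!%:R / (2 * s) *
    ((t - s)^-1 ^+ n.+1 - (t + s)^-1 ^+ n.+1).
Proof.
move=> s0; elim: n t => [|n IH] t.
  rewrite -subr_eq0 subr_sqr mulf_eq0 negb_or => /andP[tm tp].
  rewrite derive1n0 subr_sqr fact0 expr0 !expr1; field.
  by rewrite tm tp s0.
move=> ts; rewrite derive1nS derive1E.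
rewrite (near_eq_derive _ (g := fun u : R => (-1) ^+ n * n`!%:R / (2 * s) *
  ((u - s)^-1 ^+ n.+1 - (u + s)^-1 ^+ n.+1))); last first.
  move: ts; rewrite eqf_sqr negb_or => /andP[t1 t2].
  (* The difference quotient only sees points avoiding both poles. *)
  have N : nbhs t ([set u : R | u != s] `&` [set u | u != - s])%classic.
    apply: open_nbhs_nbhs; split; last by split.
    by apply: openI; apply: open_neq.
  by apply: filterS N => u [u1 u2]; rewrite IH // eqf_sqr negb_or; apply/andP.
move: ts; rewrite -subr_eq0 subr_sqr mulf_eq0 negb_or => /andP[tm tp].
have Dm := is_derive_invX n tm.
have Dp := @is_derive_invX (- s) t n; rewrite opprK in Dp.
have {}Dp := Dp tp.
have D := is_deriveZ ((-1) ^+ n * n`!%:R / (2 * s)) (is_deriveB Dm Dp).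
transitivity ('D_1 ((-1) ^+ n * n`!%:R / (2 * s) *:
    ((fun u : R => (u - s)^-1 ^+ n.+1) - (fun u : R => (u + s)^-1 ^+ n.+1))) t).
  by congr ('D_1 _ t); apply/funext.
rewrite (@derive_val _ _ _ _ _ _ _ D) factS natrM (exprS (-1)) /GRing.scale /=.
by field.
Qed.

(** At t = s cayley q the quantities t - s and t + s are c and c q with
    c = 2 s / (q - 1), so that the n-th derivative is proportional to
    c^(-n-1) (1 - q^(-n-1)) and the step becomes a rational identity in q. *)
Lemma householder_step s q d : s != 0 -> q != 0 -> `|q| != 1 ->
  let g := fun u : R => 1 / (u ^+ 2 - s ^+ 2) in
  let t := s * cayley q in
  t + d.+1%:R * (g^`(d)%classic t / g^`(d.+1)%classic t) =
    s * cayley (q ^+ d.+2).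
Proof.
move=> s0 q0 q1 g t.
have [qm _] := norm_neq1 q1.
have [qd _] := norm_neq1 (normX_neq1 q1 (ltn0Sn d.+1)).
have tm : t - s = 2 * s / (q - 1) by rewrite /t /cayley; field.
have tp : t + s = 2 * s * q / (q - 1) by rewrite /t /cayley; field.
have ts : t ^+ 2 != s ^+ 2.
  rewrite -subr_eq0 subr_sqr tm tp.
  by rewrite !mulf_neq0 ?invr_neq0 ?pnatr_eq0.
have c0 : 2 * s / (q - 1) != 0 by rewrite !mulf_neq0 ?invr_neq0 ?pnatr_eq0.
have gE n : g^`(n)%classic t = (-1) ^+ n * n`!%:R / (2 * s) *
    ((2 * s / (q - 1)) ^- n.+1 * (q ^+ n.+1 - 1) / q ^+ n.+1).
  rewrite derive1n_inv_sqrB // tm tp; congr (_ * _).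
  rewrite (_ : 2 * s * q / (q - 1) = 2 * s / (q - 1) * q); last by ring.
  move: (2 * s / (q - 1)) c0 => c c0.
  by rewrite !exprVn exprMn; field; rewrite !expf_neq0.
rewrite !gE factS natrM.
set c := 2 * s / (q - 1) in c0 *.
have fd : d`!%:R != 0 :> R by rewrite pnatr_eq0 -lt0n fact_gt0.
have dd : d.+1%:R != 0 :> R by rewrite pnatr_eq0.
have sg : (-1) ^+ d != 0 :> R by rewrite signr_eq0.
have cd : c ^+ d.+1 != 0 by rewrite expf_neq0.
have qq : q ^+ d.+1 != 0 by rewrite expf_neq0.
rewrite (exprS c d.+1) (exprS q d.+1) in qd *.
rewrite (exprS (-1)).
move: qq cd sg dd fd qd.
move: (q ^+ d.+1) (c ^+ d.+1) ((-1) ^+ d : R) => Q C e.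
move: (d.+1%:R) (d`!%:R : R) => D f Q0 C0 e0 D0 f0 QQ.
rewrite /t /c /cayley; field.
by rewrite QQ Q0 q0 qm C0 s0 f0 D0 e0.
Qed.

End Householder.

(** * Iterating the power map *)

Section Iterates.
Variable R : realFieldType.
Implicit Types (z s : R) (h : nat -> R) (n p : nat).

(** One step of odd order n: the coordinate of every iterate but the starting
    point is a square z^2, and the step raises it to the power n+1. *)
Lemma chebT_mul_cayley z n : z != 0 -> `|z| != 1 ->
  cayley (z ^+ (2 * n.+1)) =
    cayley (z ^+ 2) * ((chebT n.+1).[jouk z] / (jouk z * (chebU n).[jouk z])).
Proof.
move=> z0 z1; have [U0 ->] := chebTU_cayley n z0 z1.
have [_] := chebTU_cayley 0 z0 z1; rewrite muln1 => ->.
rewrite [(chebT 1).[_]]hornerX [(chebU 0).[_]]hornerC.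
by field; rewrite -expr2 z0 jouk_neq0 // U0 (norm_neq1 (normX_neq1 z1 _)).1.
Qed.

(** The first step of odd order starts from the coordinate - z, whereas the
    first iterate has an even power of z as coordinate; hence the factor
    jouk z - 1 that appears once and for all in the product formula. *)
Lemma chebT_sub1_cayley z n : z != 0 -> `|z| != 1 ->
  cayley (z ^+ (2 * n.+1)) =
    cayley (- z) *
      ((chebT n.+1).[jouk z] / ((jouk z - 1) * (chebU n).[jouk z])).
Proof.
move=> z0 z1; have [U0 ->] := chebTU_cayley n z0 z1.
have [zm zp] := norm_neq1 z1.
have j1 : jouk z - 1 = (z - 1) ^+ 2 / (2 * z) by rewrite /jouk; field.
rewrite j1 /cayley; field.
by rewrite U0 z0 zm -!opprD oppr_eq0 zp -expr2 (norm_neq1 (normX_neq1 z1 _)).1.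
Qed.

Lemma even_ratio z s h p n : z != 0 -> `|z| != 1 ->
  (forall m, h m = s * cayley ((- z) ^+ ((2 * p + 1) ^ m))) ->
  let y := (chebT ((2 * p + 1) ^ n)%N).[jouk z] in
  (chebV p).[y] != 0 /\ h n.+1 = h n * ((chebW p).[y] / (chebV p).[y]).
Proof.
move=> z0 z1 hE; rewrite /= chebT_jouk //.
have zN m : (- z) ^+ ((2 * p + 1) ^ m) = - z ^+ ((2 * p + 1) ^ m).
  rewrite exprNn -signr_odd oddX oddD oddM /= orbT expr1 mulN1r //.
have w1 : `|z ^+ ((2 * p + 1) ^ n)| != 1.
  by rewrite normX_neq1 // expn_gt0 addn1.
have [V0 e] := chebWV_cayley p (expf_neq0 _ z0) w1.
by split=> //; rewrite !hE !zN expnSr exprM e; ring.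
Qed.

Lemma even_prod z s h p n : z != 0 -> `|z| != 1 ->
  (forall m, h m = s * cayley ((- z) ^+ ((2 * p + 1) ^ m))) ->
  h n = h 0%N *
    (\prod_(1 <= j < n.+1)
        (chebW p).[(chebT ((2 * p + 1) ^ (j - 1))%N).[jouk z]]
     / \prod_(1 <= j < n.+1)
        (chebV p).[(chebT ((2 * p + 1) ^ (j - 1))%N).[jouk z]]).
Proof.
move=> z0 z1 hE; elim: n => [|n IH]; first by rewrite !big_geq // divr1 mulr1.
have [_ ->] := even_ratio n z0 z1 hE.
by rewrite !(big_nat_recr n.+1) //= subn1 /= IH invfM; ring.
Qed.

Lemma half_expn M n : ((2 * M) ^ n.+1 %/ 2 = M * (2 * M) ^ n)%N.
Proof. by rewrite expnS -mulnA mulKn. Qed.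

(** Valid from the first iterate on: for an even exponent d+1 = 2M the sign of
    - z is lost after one step, and the coordinate becomes the square of y. *)
Lemma odd_step z s h M k : z != 0 -> `|z| != 1 -> (0 < M)%N ->
  (forall m, h m = s * cayley ((- z) ^+ ((2 * M) ^ m))) ->
  let y := z ^+ (M * (2 * M) ^ k) in
  [/\ jouk y != 0, (chebU (2 * M).-1).[jouk y] != 0 &
   h k.+2 = h k.+1 * ((chebT (2 * M)).[jouk y]
                      / (jouk y * (chebU (2 * M).-1).[jouk y]))].
Proof.
move=> z0 z1 M0 hE y.
have M2 : (0 < 2 * M)%N by rewrite muln_gt0.
have y0 : y != 0 by rewrite expf_neq0.
have y1 : `|y| != 1 by rewrite normX_neq1 // muln_gt0 M0 expn_gt0 M2.
have zN m : (- z) ^+ ((2 * M) ^ m.+1) = z ^+ ((2 * M) ^ m.+1).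
  by rewrite exprNn -signr_odd oddX oddM /= expr0 mul1r.
have hy : h k.+1 = s * cayley (y ^+ 2).
  by rewrite hE zN -exprM; congr (s * cayley (z ^+ _)); rewrite expnS; ring.
have hy' : h k.+2 = s * cayley (y ^+ (2 * (2 * M))).
  by rewrite hE zN -exprM; congr (s * cayley (z ^+ _)); rewrite !expnS; ring.
have := chebT_mul_cayley (2 * M).-1 y0 y1.
rewrite prednK // hy hy' => ->.
split; [exact: jouk_neq0|exact: (chebTU_cayley _ y0 y1).1|by ring].
Qed.

Lemma odd_first z s h M : z != 0 -> `|z| != 1 -> (0 < M)%N ->
  (forall m, h m = s * cayley ((- z) ^+ ((2 * M) ^ m))) ->
  h 1%N = h 0%N * ((chebT M).[jouk z] / ((jouk z - 1) * (chebU M.-1).[jouk z])).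
Proof.
move=> z0 z1 M0 hE; rewrite !hE expn0 expn1 expr1.
rewrite exprNn -signr_odd oddM /= expr0 mul1r.
by rewrite -{1}(prednK M0) chebT_sub1_cayley // prednK //; ring.
Qed.

(** The quotients T / U of successive steps telescope in part: the argument
    y of U satisfies jouk y = T_(N^(k+1)/2) (jouk z), which is also the
    numerator reached so far, and factoring U at y yields the other products. *)
Lemma odd_prod z s h b p k : z != 0 -> `|z| != 1 ->
  let N := (2 * (2 ^ b * (2 * p + 1)))%N in
  (forall m, h m = s * cayley ((- z) ^+ (N ^ m))) ->
  h k.+1 = h 0%N / 2 ^+ (b.+1 * k.+1 - 1)
    * ((chebT (N ^ k.+1 %/ 2)%N).[jouk z]
       / ((jouk z - 1)
          * (\prod_(0 <= j < k) (chebT (N ^ (j + 1) %/ 2)%N).[jouk z])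
          * (\prod_(0 <= j < k.+1) \prod_(0 <= i < b)
               (chebT (2 ^ i * N ^ j)%N).[jouk z])
          * (\prod_(0 <= j < k.+1)
               (chebW p).[(chebT (2 ^ b.+1 * N ^ j)%N).[jouk z]]))).
Proof.
move=> z0 z1; set M := (2 ^ b * (2 * p + 1))%N; move=> N hE.
have M0 : (0 < M)%N by rewrite muln_gt0 expn_gt0 addn1.
have N0 : (0 < N)%N by rewrite muln_gt0.
elim: k => [|k IH].
  rewrite (odd_first z0 z1 M0 hE) -subn1 chebU_factor //.
  rewrite !big_nat1 big_nil !expn0 half_expn expn0 !muln1 subn1 /=.
  under [in RHS]eq_bigr do rewrite muln1.
  by rewrite !invfM invr1; ring.
have [T0 _ ->] := odd_step k z0 z1 M0 hE.
rewrite {}IH; set y := z ^+ _ in T0 *.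
have y0 : y != 0 by rewrite expf_neq0.
have y1 : `|y| != 1 by rewrite normX_neq1 // muln_gt0 M0 expn_gt0 N0.
have yk : y = z ^+ (N ^ k.+1 %/ 2) by rewrite half_expn.
have y2 : y ^+ 2 = z ^+ (N ^ k.+1).
  by rewrite -exprM; congr (z ^+ _); rewrite expnS /N; ring.
have yN : (chebT (2 * M)).[jouk y] = (chebT (N ^ k.+2 %/ 2)).[jouk z].
  rewrite !chebT_jouk // half_expn -exprM; congr (jouk (z ^+ _)).
  by rewrite expnS; ring.
have yU : (chebU (2 * M).-1).[jouk y] = 2 ^+ b.+1 *
    (jouk y * \prod_(0 <= i < b) (chebT (2 ^ i * N ^ k.+1)%N).[jouk z]) *
    (chebW p).[(chebT (2 ^ b.+1 * N ^ k.+1)%N).[jouk z]].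
  rewrite -subn1 /M mulnA -expnS chebU_factor //.
  rewrite big_nat_recl // expn0 {1}chebT_jouk // expr1.
  congr (_ * (_ * _) * _.[_]).
    apply: eq_bigr => i _; rewrite !chebT_jouk //; congr jouk.
    by rewrite expnS exprM y2 -exprM mulnC.
  rewrite !chebT_jouk //; congr jouk.
  by rewrite expnS exprM y2 -exprM mulnC.
rewrite yN yU [in RHS](big_nat_recr k) //= !(big_nat_recr k.+1) //=.
rewrite addn1 !(chebT_jouk (N ^ k.+1 %/ 2)) // -yk.
have -> : (b.+1 * k.+2 - 1 = (b.+1 * k.+1 - 1) + b.+1)%N by lia.
rewrite exprD.
set A := \prod_(0 <= j < k) _; set B := \prod_(0 <= j < k.+1) _.
set C := \prod_(0 <= j < k.+1) _; set P := \prod_(0 <= i < b) _.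
move: A B C P (jouk y) T0 => A B C P J J0.
rewrite !invfM.
(* The numerator J reached so far cancels against one of the two J in the new
   denominator; the other one enters the product A. *)
transitivity (J / J * (h 0%N * (2 ^- (b.+1 * k.+1 - 1) / 2 ^+ b.+1) *
  ((chebT (N ^ k.+2 %/ 2)).[jouk z] *
   ((jouk z - 1)^-1 * (A^-1 / J) * (B^-1 / P) *
    (C^-1 / (chebW p).[(chebT (2 ^ b.+1 * N ^ k.+1)).[jouk z]]))))).
  by ring.
by rewrite divff // mul1r.
Qed.

End Iterates.

(** * The 2-adic decomposition of the order *)

Lemma odd_decomp_val a p d : d = (2 ^ (a + 1) * p + 2 ^ a - 1)%N ->
  (d + 1 = 2 ^ a * (2 * p + 1))%N.
Proof.
move=> ->; rewrite subnK ?addn_gt0 ?expn_gt0 ?orbT //.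
by rewrite addn1 expnSr mulnDr muln1 mulnA.
Qed.

Lemma logn2_mul_odd a p : logn 2 (2 ^ a * (2 * p + 1)) = a.
Proof.
rewrite lognM ?expn_gt0 ?addn1 // pfactorK // [X in (_ + X)%N]lognE /=.
by rewrite dvdn2 /= oddM /= addn0.
Qed.

Lemma odd_decomp d : odd d ->
  exists! ap : nat * nat,
    (1 <= ap.1)%N /\ d = (2 ^ (ap.1 + 1) * ap.2 + 2 ^ ap.1 - 1)%N.
Proof.
have d1 : (0 < d + 1)%N by rewrite addn1.
move=> od; have [m m_odd dE] := pfactor_coprime (isT : prime 2) d1.
rewrite coprime2n in m_odd.
set a := logn 2 (d + 1) in dE.
have mE : (m = 2 * m./2 + 1)%N.
  by rewrite mul2n -{1}(odd_double_half m) m_odd addnC.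
exists (a, m./2); split => /=.
  split.
    rewrite lt0n; apply/eqP => a0; move: dE; rewrite a0 muln1 => dE.
    by move: m_odd; rewrite -dE oddD od.
  rewrite addn1 expnSr -mulnA -{2}(muln1 (2 ^ a)%N) -mulnDr -mE mulnC -dE.
  by rewrite addnK.
move=> [a' p'] /= [_ /odd_decomp_val dE'].
have aE : a = a' by rewrite /a dE' logn2_mul_odd.
congr (_, _) => //; move: dE; rewrite dE' mulnC aE => /eqP.
by rewrite eqn_pmul2r ?expn_gt0 // => /eqP; lia.
Qed.

(** * Householder's iterates for the square root *)

Theorem corollary10 (R : realType) (x : R) (d : nat) (r : R) (H : nat -> R) :
  0 < x -> (1 <= d)%N -> r != 0 -> r ^+ 2 != x ->
  let g : R -> R := fun t => 1 / (t ^+ 2 - x) in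
  H 0%N = r ->
  (forall n : nat, H n.+1 = H n + d%:R * (g^`(d - 1)%classic (H n) / g^`(d)%classic (H n))) ->
  let X : R := (x + r ^+ 2) / (x - r ^+ 2) in
  (forall p : nat, d = (2 * p)%N ->
     forall n : nat,
       H n = r * (\prod_(1 <= j < n.+1)
                     (chebW p).[(chebT ((2 * p + 1) ^ (j - 1))%N).[X]]
                  / \prod_(1 <= j < n.+1)
                     (chebV p).[(chebT ((2 * p + 1) ^ (j - 1))%N).[X]])
       /\ H n.+1 - H n =
            2 * H n * ((chebU (p - 1)%N).[(chebT ((2 * p + 1) ^ n)%N).[X]]
                       / (chebV p).[(chebT ((2 * p + 1) ^ n)%N).[X]]))
  /\
  (odd d ->
     (exists! ap : nat * nat,
        (1 <= ap.1)%N /\ d = (2 ^ (ap.1 + 1) * ap.2 + 2 ^ ap.1 - 1)%N)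
     /\
     (forall alpha p : nat,
        (1 <= alpha)%N -> d = (2 ^ (alpha + 1) * p + 2 ^ alpha - 1)%N ->
        alpha = logn 2 (d + 1)
        /\
        forall n : nat, (1 <= n)%N ->
          H n = r / 2 ^+ (alpha * n - 1)
                * ((chebT ((d + 1) ^ n %/ 2)%N).[X]
                   / ((X - 1)
                      * (\prod_(0 <= j < n - 1)
                           (chebT ((d + 1) ^ (j + 1) %/ 2)%N).[X])
                      * (\prod_(0 <= j < n) \prod_(0 <= k < alpha - 1)
                           (chebT (2 ^ k * (d + 1) ^ j)%N).[X])
                      * (\prod_(0 <= j < n)
                           (chebW p).[(chebT (2 ^ alpha * (d + 1) ^ j)%N).[X]]))))
     /\
     (forall n : nat, (1 <= n)%N ->
        let Xn : R := (chebT ((d + 1) ^ n %/ 2)%N).[X] in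
        H n.+1 = H n * ((chebT (d + 1)%N).[Xn] / (Xn * (chebU d).[Xn]))
        /\ H n.+1 - H n =
             - H n * ((chebU (d - 1)%N).[Xn] / (Xn * (chebU d).[Xn])))).
Proof.
move=> x_gt0 d_gt0 r0 r2x g H0 HS X.
set s : R := Num.sqrt x.
have s0 : s != 0 by rewrite gt_eqF // sqrtr_gt0.
have xE : x = s ^+ 2 by rewrite sqr_sqrtr // ltW.
have [rm rp] : r - s != 0 /\ r + s != 0.
  by apply/andP; move: r2x; rewrite xE -subr_eq0 subr_sqr mulf_eq0 negb_or.
pose z := - ((r + s) / (r - s)).
have z0 : z != 0 by rewrite oppr_eq0 mulf_neq0 ?invr_neq0.
have z1 : `|z| != 1.
  rewrite -sqr_norm_eq1 -subr_eq0.
  rewrite (_ : z ^+ 2 - 1 = 4 * r * s / (r - s) ^+ 2).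
    by rewrite !mulf_neq0 ?invr_neq0 ?expf_neq0 ?pnatr_eq0.
  by rewrite /z; field.
have XE : X = jouk z.
  rewrite /X /jouk /z xE; field.
  by rewrite rm rp -oppr_eq0 opprB subr_sqr mulf_neq0.
have rE : r = s * cayley (- z).
  rewrite /z opprK /cayley; field.
  rewrite rm (_ : r + s + -1 * (r - s) = 2 * s); last by ring.
  by rewrite mulf_neq0 ?pnatr_eq0.
clearbody z.
have HE m : H m = s * cayley ((- z) ^+ ((d + 1) ^ m)).
  elim: m => [|m IH]; first by rewrite H0 expn0 expr1.
  rewrite HS IH; set q := (- z) ^+ _.
  have q0 : q != 0 by rewrite expf_neq0 ?oppr_eq0.
  have q1 : `|q| != 1 by rewrite normX_neq1 ?normrN // expn_gt0 addn1.
  have := householder_step d.-1 s0 q0 q1.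
  rewrite prednK // -xE -subn1 => ->.
  by rewrite /q -exprM -(addn1 d) -expnSr.
rewrite {X}XE; split.
  move=> p dE n; rewrite dE in HE.
  split; first by rewrite (even_prod n z0 z1 HE) H0.
  have [V0 ->] := even_ratio n z0 z1 HE.
  have p_gt0 : (0 < p)%N by lia.
  rewrite -{1 4}(prednK p_gt0) chebW_chebV prednK // -subn1.
  rewrite hornerD -polyC_natr hornerM hornerC; field.
  exact: V0.
move=> od; split; first exact: odd_decomp.
split.
  move=> [//|b] p _ dE; have d1 := odd_decomp_val dE.
  split; first by rewrite d1 logn2_mul_odd.
  move=> [//|k] _.
  have d2 : (d + 1 = 2 * (2 ^ b * (2 * p + 1)))%N by rewrite d1 expnS mulnA.
  rewrite d2 in HE *.
  by rewrite (odd_prod k z0 z1 HE) H0 !subn1.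
have [M dM] : exists M, (d + 1 = 2 * M)%N by exists (d + 1)./2; lia.
have M0 : (0 < M)%N by lia.
move=> [//|k] _ Xn.
rewrite dM in HE.
have [J0 U0 HS'] := odd_step k z0 z1 M0 HE.
have dE : (2 * M).-1 = d by rewrite -dM addn1.
have XnE : Xn = jouk (z ^+ (M * (2 * M) ^ k)).
  by rewrite /Xn dM half_expn chebT_jouk.
rewrite dE -XnE -dM in J0 U0 HS'.
split=> //.
(* The two identities differ by T_(d+1) = 'X U_d - U_(d-1), evaluated at Xn. *)
have TE : (chebT (d + 1)).[Xn] = Xn * (chebU d).[Xn] - (chebU (d - 1)).[Xn].
  case: (d) d_gt0 => [//|e] _; rewrite addn1 subn1 /= chebT_chebU.
  by rewrite hornerD hornerN hornerM hornerX.
by rewrite HS' TE; field; rewrite U0 J0.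
Qed.
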